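(* Let $\alpha\in(0,1)$, $\kappa>0$ and $\kappa_1>0$ be constants. There exists a constant $C>0$ (depending only on $\kappa,\kappa_1,\alpha$) such that for all integers $n,T\ge2$ and all $\tau_0\ge\tau_1\ge\tau_2>0$ with $\tau_1,\tau_0\le\kappa\sqrt{nT}/12$ and $\tau_2\ge\kappa_1$, $$\mathcal{L}(\mathcal{M}^{(1)},\mathcal{M}^{(2)})\ge C .$$
   Context: Model: $X=M+u$ where $M\in\mathbb{R}^{n\times T}$ is non-random and the entries $u_{i,t}$ of $u\in\mathbb{R}^{n\times T}$ are i.i.d. $N(0,1)$. The observed data is $X_{-1,-1}$, i.e. all entries of $X$ except the $(1,1)$ entry (formally, $A_{-1,-1}$ is $A$ with its $(1,1)$ entry replaced by zero). $\mathbb{P}_M,\mathbb{E}_M$ denote probability and expectation when the mean matrix is $M$. For a matrix $A$, $\|A\|_\infty=\max_{i,j}|A_{i,j}|$ and $\sigma_1(A)\ge\sigma_2(A)\ge\cdots$ are its singular values. Define $\mathcal{M}=\{A\in\mathbb{R}^{n\times T}:\|A\|_\infty\le\kappa,\ \mathrm{rank}\,A\le2\}$, $\mathcal{M}^{(1)}=\{A\in\mathcal{M}:\sigma_1(A)\ge\tau_0,\ \sigma_2(A)=0\}$, $\mathcal{M}^{(2)}=\{A\in\mathcal{M}:\sigma_1(A)\ge\tau_1,\ \sigma_2(A)\le\tau_2\}$. $\Phi(\mathcal{M}^{(2)})$ is the set of (measurable) confidence intervals $CI(\cdot)=[l(\cdot),u(\cdot)]$, $l\le u$, with $\inf_{M\in\mathcal{M}^{(2)}}\mathbb{P}_M(M_{1,1}\in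 CI(X_{-1,-1}))\ge1-\alpha$; $|CI(\cdot)|=u(\cdot)-l(\cdot)$; and $$\mathcal{L}(\mathcal{M}^{(1)},\mathcal{M}^{(2)})=\inf_{CI\in\Phi(\mathcal{M}^{(2)})}\ \sup_{M\in\mathcal{M}^{(1)}}\mathbb{E}_M|CI(X_{-1,-1})|.$$ *)

(* Defs.v *)
From HB Require Import structures.
From mathcomp Require Import all_boot all_order all_algebra.
From mathcomp Require Import polyrcf.
From mathcomp Require Import all_classical all_reals all_analysis.

Set Implicit Arguments.
Unset Strict Implicit.
Unset Printing Implicit Defensive.

Import Order.TTheory GRing.Theory Num.Theory.
Import numFieldNormedType.Exports.

Local Open Scope classical_set_scope.
Local Open Scope ring_scope.

Section singular_values.
Context {R : realType} {n T : nat}.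
Implicit Type A : 'M[R]_(n, T).

(* Square roots of the eigenvalues of A^T A, repeated according to their
   multiplicity as roots of the characteristic polynomial. [A^T *m A] is T x T,
   so this lists T values; if n < T, at least T - n of them are 0. *)
Definition singular_values A : seq R :=
  let p := char_poly (A^T *m A) in
  sort >=%R (flatten [seq nseq (mup x p) (Num.sqrt x) | x <- rootsR p]).

(* Numbered from 1: [singular_value 1 A] is the largest one. *)
Definition singular_value (k : nat) A : R := (singular_values A)`_k.-1.

End singular_values.

Section matrix_classes.
Context {R : realType} {n T : nat}.

(* [mx_norm] is the entrywise maximum norm. *)
Definition classM (kappa : R) : set 'M[R]_(n, T) :=
  [set A | mx_norm A <= kappa /\ (\rank A <= 2)%N].

Definition classM1 (kappa tau0 : R) : set 'M[R]_(n, T) :=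
  [set A | [/\ classM kappa A, tau0 <= singular_value 1 A
             & singular_value 2 A = 0]].

Definition classM2 (kappa tau1 tau2 : R) : set 'M[R]_(n, T) :=
  [set A | [/\ classM kappa A, tau1 <= singular_value 1 A
             & singular_value 2 A <= tau2]].

End matrix_classes.

(* The product sigma-algebra on n x T matrices: it is generated by the entries.
   It coincides with the Borel sigma-algebra. *)
Definition mx_entry_events (R : realType) (n T : nat) :
    set (set 'M[R]_(n, T)) :=
  \bigcup_(ij in [set: 'I_n * 'I_T])
    preimage_set_system setT (fun A : 'M[R]_(n, T) => A ij.1 ij.2) measurable.

Definition measurable_mx (R : realType) (n T : nat) :=
  g_sigma_algebraType (@mx_entry_events R n T).

Record interval_procedure (R : realType) (n T : nat) := IntervalProcedure {
  lower : 'M[R]_(n, T) -> R;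
  upper : 'M[R]_(n, T) -> R;
  measurable_lower : measurable_fun setT (lower : measurable_mx R n T -> R);
  measurable_upper : measurable_fun setT (upper : measurable_mx R n T -> R);
  lower_le_upper : forall x, lower x <= upper x }.

Definition mask_entry (R : realType) (n T : nat) (i0 : 'I_n) (j0 : 'I_T)
    (A : 'M[R]_(n, T)) : 'M[R]_(n, T) :=
  \matrix_(i, j) if (i == i0) && (j == j0) then 0 else A i j.

Section model.
Context {R : realType} {n T : nat} {d : measure_display}.
Context {Omega : measurableType d} (P : probability Omega R).

Definition mutually_independent (I : finType) (X : I -> {RV P >-> R}) : Prop :=
  forall (J : {set I}) (B : I -> set R),
    (forall k, k \in J -> measurable (B k)) ->
    P (\bigcap_(k in [set` J]) (X k @^-1` B k)) =
      (\prod_(k in J) P (X k @^-1` B k))%E.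

(* Laws are compared on measurable sets only: the values of a measure on
   non-measurable sets are meaningless. *)
Definition iid_std_normal (u : 'I_n -> 'I_T -> {RV P >-> R}) : Prop :=
  (forall i j (B : set R), measurable B ->
     distribution P (u i j) B = normal_prob 0 1 B) /\
  mutually_independent (fun ij : 'I_n * 'I_T => u ij.1 ij.2).

Variable u : 'I_n -> 'I_T -> {RV P >-> R}.

(* The probability P is fixed and the mean matrix M enters through the data
   M + u, so that the P_M-law of X is the P-law of M + u. *)
Definition full_data (M : 'M[R]_(n, T)) (w : Omega) : 'M[R]_(n, T) :=
  M + \matrix_(i, j) u i j w.

(* (i0, j0) is the position of the missing entry. *)
Variables (i0 : 'I_n) (j0 : 'I_T).

Definition observed_data (M : 'M[R]_(n, T)) (w : Omega) : 'M[R]_(n, T) :=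
  mask_entry i0 j0 (full_data M w).

Definition coverage (CI : interval_procedure R n T) (M : 'M[R]_(n, T)) :
    \bar R :=
  P [set w | lower CI (observed_data M w) <= M i0 j0
             <= upper CI (observed_data M w)].

Definition expected_length (CI : interval_procedure R n T)
    (M : 'M[R]_(n, T)) : \bar R :=
  ('E_P[fun w => (upper CI (observed_data M w)
                  - lower CI (observed_data M w))%R])%E.

Definition valid_CI (alpha : R) (N : set 'M[R]_(n, T)) :
    set (interval_procedure R n T) :=
  [set CI | ((1 - alpha)%:E <= ereal_inf [set coverage CI M | M in N])%E].

Definition minimax_length (alpha : R) (N1 N2 : set 'M[R]_(n, T)) : \bar R :=
  ereal_inf [set ereal_sup [set expected_length CI M | M in N1]
            | CI in valid_CI alpha N2].

End model.

(* Main.v *)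
Require Import Defs.
From HB Require Import structures.
From mathcomp Require Import all_boot all_order all_algebra.
From mathcomp Require Import polyrcf.
From mathcomp Require Import all_classical all_reals all_analysis.
From mathcomp Require Import measurable_realfun ring lra.

Set Implicit Arguments.
Unset Strict Implicit.
Unset Printing Implicit Defensive.

Import Order.TTheory GRing.Theory Num.Theory.
Import numFieldNormedType.Exports.

Local Open Scope classical_set_scope.
Local Open Scope ring_scope.

(** The bound comes from non-identifiability of the missing entry. Let [M_t] be
the constant matrix with entries [a = kappa / 12], with [t] added to its missing
entry. Masking that entry erases [t], so the observed data of all the [M_t] are
one and the same random matrix, while the target [a + t] moves. For [t] between [0] and [Delta = min(kappa1, kappa /
2)], every [M_t] lies in the class on which coverage is required: its largest
singular value is at least [a * sqrt(n T)], which is the upper bound imposed on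
[tau0] and [tau1], and its second one is at most [t <= kappa1 <= tau2]. Moreover
[M_0] has rank one, so it lies in the class on which length is measured. Hence
a valid interval, computed under [M_0], covers each point of [[a, a + Delta]]
with probability at least [1 - alpha]. By Tonelli the expected length of an
interval is the integral over [x] of the probability that it covers [x]
([expected_length_ge_coverage]), so it is at least [(1 - alpha) * Delta].
Averaging over a whole segment of values of [t] is what handles every [alpha]
in [(0, 1)]: two values, each covered with probability [1 - alpha], need not be
covered together when [alpha >= 1/2].

The singular values are defined through the roots of the characteristic
polynomial of the [T x T] matrix [A^T A], which [char_poly_mulmxC] reduces to a
[2 x 2] one: [M_t] is a product [U V] with inner dimension two. The trace and
determinant of [U^T U V V^T] are explicit, and [quadratic_roots] turns them
into the two bounds above ([singular_value_spiked_mx]). *)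

(** * Characteristic polynomials and singular values *)

(** The lower left block of [N = [['X, B], [A, 1]]] can be cleared in two ways.
Multiplying on the right by [[1, 0], [-A, 1]] gives [\det N = char_poly (B *m A)];
multiplying on the left by [[1, 0], [-A, 'X]], of determinant ['X ^+ m], leaves
['X] and ['X - A *m B] on the diagonal. *)
Lemma char_poly_mulmxC (F : comNzRingType) m n (A : 'M[F]_(m, n))
    (B : 'M[F]_(n, m)) :
  'X ^+ m * char_poly (B *m A) = 'X ^+ n * char_poly (A *m B).
Proof.
pose Ap := map_mx polyC A; pose Bp := map_mx polyC B.
pose N := block_mx ('X%:M : 'M[{poly F}]_n) Bp Ap (1%:M : 'M[{poly F}]_m).
have detN : \det N = char_poly (B *m A).
  have -> : char_poly (B *m A)
      = \det (N *m block_mx 1%:M 0 (- Ap) (1%:M : 'M[{poly F}]_m)).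
    rewrite mulmx_block !mulmx1 !mulmx0 !mul1mx addrN !add0r.
    rewrite mulmxN -map_mxM -/(char_poly_mx (B *m A)).
    by rewrite det_ublock det1 mulr1.
  by rewrite det_mulmx det_lblock !det1 !mulr1.
rewrite -detN -[in LHS](@det_scalar _ m).
have -> : \det ('X%:M : 'M[{poly F}]_m)
    = \det (block_mx (1%:M : 'M[{poly F}]_n) 0 (- Ap) ('X%:M : 'M[{poly F}]_m)).
  by rewrite det_lblock det1 mul1r.
rewrite -det_mulmx mulmx_block !mul1mx !mul0mx !addr0 mulmx1.
rewrite mul_mx_scalar mul_scalar_mx scalerN addNr.
rewrite mulNmx -map_mxM [- _ + _]addrC -/(char_poly_mx (A *m B)).
by rewrite det_ublock det_scalar.
Qed.

Lemma char_poly_mx2 (F : comNzRingType) (A : 'M[F]_2) (s1 s2 : F) :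
  s1 + s2 = \tr A -> s1 * s2 = \det A ->
  char_poly A = ('X - s1%:P) * ('X - s2%:P).
Proof.
move=> trA detA.
have sA : size (char_poly A) = 3%N by rewrite size_char_poly.
have c2 : (char_poly A)`_2 = 1.
  by have /monicP := char_poly_monic A; rewrite lead_coefE sA.
have c1 : (char_poly A)`_1 = - (s1 + s2) by rewrite (@char_poly_trace _ 2) ?trA.
have c0 : (char_poly A)`_0 = s1 * s2 by rewrite char_poly_det sqrrN expr1n mul1r.
rewrite -[LHS]coefK sA poly_def !big_ord_recr big_ord0 /= c0 c1 c2.
rewrite -!mul_polyC polyCN polyCD polyCM polyC1 expr0 expr1.
ring.
Qed.

(** The defining list repeats each real root according to its multiplicity. When
the polynomial splits over the reals this is a permutation of its list of roots,
and sorting erases the order. *)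
Lemma singular_values_factored (R : realType) n T (A : 'M[R]_(n, T)) (s : seq R) :
  char_poly (A^T *m A) = \prod_(x <- s) ('X - x%:P) ->
  singular_values A = sort >=%R [seq Num.sqrt x | x <- s].
Proof.
rewrite /singular_values; set p := char_poly _ => pE.
have p0 : p != 0 by rewrite monic_neq0 ?char_poly_monic.
have rootsP x : (x \in rootsR p) = (x \in s).
  have := roots_on_rootsR p0 => /(_ x) <-.
  by rewrite in_itv /= pE root_prod_XsubC.
have -> : flatten [seq nseq (mup x p) (Num.sqrt x) | x <- rootsR p]
    = [seq Num.sqrt x | x <- flatten [seq nseq (mup x p) x | x <- rootsR p]].
  rewrite map_flatten -map_comp; congr flatten.
  by apply: eq_map => x /=; rewrite map_nseq.
apply/(perm_sortP ge_total ge_trans ge_anti).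
apply: perm_map; apply/allP => x _ /=; apply/eqP.
rewrite count_flatten -map_comp.
have -> : [seq (count_mem x \o (fun y => nseq (mup y p) y)) y | y <- rootsR p]
    = [seq (if y == x then mup x p else 0)%N | y <- rootsR p].
  apply: eq_map => y /=; rewrite count_nseq /=.
  by case: eqP => [->|]; rewrite ?mul1n ?mul0n.
rewrite sumnE big_map -big_mkcond /= big_const_seq iter_addn_0.
rewrite count_uniq_mem ?uniq_roots // rootsP pE mu_prod_XsubC.
by rewrite -has_pred1 has_count; case: count => [|k]; rewrite ?muln0 ?muln1.
Qed.

Lemma singular_value_rank2 (R : realType) n T (A : 'M[R]_(n, T)) (s1 s2 : R) k :
  char_poly (A^T *m A) = ('X - s1%:P) * ('X - s2%:P) * 'X ^+ k ->
  0 <= s2 -> s2 <= s1 ->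
  singular_value 1 A = Num.sqrt s1 /\ singular_value 2 A = Num.sqrt s2.
Proof.
move=> chiE s20 s21.
rewrite /singular_value (@singular_values_factored _ _ _ _ (s1 :: s2 :: nseq k 0)).
  rewrite (sorted_sort ge_trans) //=.
  rewrite ler_wsqrtr //= map_nseq sqrtr0 path_min_sorted.
    by elim: k {chiE} => //= -[|k] //= ->; rewrite lexx.
  by apply/allP => x /nseqP[-> _]; exact: sqrtr_ge0.
by rewrite chiE !big_cons mulrA big_nseq subr0 -Monoid.iteropE.
Qed.

(** The roots of [z^2 - t z + d] lie on either side of any point where this
polynomial is nonpositive. The hypotheses make it nonpositive at both [x] and
[y]: its value at [x] is [x^2 - t x + d <= x (x + y - t) <= 0]. In the
application [x] and [y] are squares of singular values of the two summands of
[spiked_mx], and the bound on [s2] is Weyl's inequality for the second singular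
value of their sum. *)
Lemma quadratic_roots (R : rcfType) (x y t d : R) :
  0 <= x -> 0 <= y -> x + y <= t -> 0 <= d -> d <= x * y ->
  exists s1 s2, [/\ s1 + s2 = t, s1 * s2 = d, x <= s1, 0 <= s2 <= y & s2 <= s1].
Proof.
move=> x0 y0 xyt d0 dxy.
have D0 : (x - y) ^+ 2 <= t ^+ 2 - 4 * d.
  have : (x + y) ^+ 2 <= t ^+ 2 by rewrite lerXn2r // nnegrE; lra.
  by lra.
have rE := sqr_sqrtr (le_trans (sqr_ge0 _) D0).
(* [(t - 2 z)^2 - (t^2 - 4 d)] is four times the value of the polynomial at [z]. *)
have bound z : (t - 2 * z) ^+ 2 <= t ^+ 2 - 4 * d ->
    `|t - 2 * z| <= Num.sqrt (t ^+ 2 - 4 * d).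
  by move=> ?; rewrite -sqrtr_sqr ler_wsqrtr.
have rt : Num.sqrt (t ^+ 2 - 4 * d) <= t.
  by rewrite -[leRHS]ger0_norm -?sqrtr_sqr ?ler_wsqrtr //; lra.
have /ler_normlP[xr _] : `|t - 2 * x| <= Num.sqrt (t ^+ 2 - 4 * d).
  by apply: bound; nra.
have /ler_normlP[_ yr] : `|t - 2 * y| <= Num.sqrt (t ^+ 2 - 4 * d).
  by apply: bound; nra.
move: rE (sqrtr_ge0 (t ^+ 2 - 4 * d)) rt xr yr.
set r := Num.sqrt _ => rE r0 rt xr yr.
exists ((t + r) / 2), ((t - r) / 2); split; [lra| |lra|lra|lra].
rewrite (_ : _ * _ = (t ^+ 2 - r ^+ 2) / 4); last by field.
by rewrite rE; field.
Qed.

Lemma det_block_scalar11 (F : comNzRingType) (a b c d : F) :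
  \det (block_mx a%:M b%:M c%:M d%:M : 'M[F]_(1 + 1)) = a * d - b * c.
Proof.
have e1 : lift (lshift 1 (0 : 'I_1)) (0 : 'I_1) = rshift 1 0 by exact/val_inj.
have e2 : lift (rshift 1 (0 : 'I_1)) (0 : 'I_1) = lshift 1 0 by exact/val_inj.
move defM: (block_mx _ _ _ _) => M.
rewrite (expand_det_row _ (lshift 1 0)) big_split_ord !big_ord1 /cofactor.
rewrite !det_mx11 !mxE /= e1 e2 -defM.
rewrite block_mxEul block_mxEur block_mxEdr block_mxEdl !mxE /=.
by rewrite expr0 expr1 mul1r mulN1r mulrN.
Qed.

(** * A constant matrix with one spiked entry *)

Section spike.
Context {R : realType} {n T : nat}.
Context (i0 : 'I_n) (j0 : 'I_T) (a t : R).

Definition spiked_mx : 'M[R]_(n, T) := const_mx a + t *: delta_mx i0 j0.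

(* The inner dimension is written [1 + 1] so that products are computed by blocks. *)
Let U : 'M[R]_(n, 1 + 1) := row_mx (const_mx 1) (delta_mx i0 0).
Let V : 'M[R]_(1 + 1, T) := col_mx (const_mx a) (t *: delta_mx 0 j0).

Let spiked_mxE : spiked_mx = U *m V.
Proof.
rewrite /U /V mul_row_col -scalemxAr mul_delta_mx; congr (_ + _).
by apply/matrixP => i j; rewrite !mxE big_ord1 !mxE mul1r.
Qed.

Lemma rank_spiked_mx : (\rank spiked_mx <= 2)%N.
Proof. by rewrite spiked_mxE mulmx_max_rank. Qed.

Let UU : U^T *m U = block_mx n%:R%:M 1 1 1.
Proof.
rewrite /U tr_row_mx mul_col_row trmx_delta mul_delta_mx.
congr block_mx; apply/matrixP => i j; rewrite !ord1 !mxE.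
- under eq_bigr do rewrite !mxE mulr1.
  by rewrite sumr_const card_ord mulr1n.
- rewrite (bigD1 i0) //= big1 ?mxE ?eqxx /= ?mulr1 ?addr0 //.
  by move=> k /negPf k0; rewrite !mxE k0 mulr0.
- rewrite (bigD1 i0) //= big1 ?mxE ?eqxx /= ?mulr1 ?addr0 //.
  by move=> k /negPf k0; rewrite !mxE k0 mul0r.
- by [].
Qed.

Let VV : V *m V^T = block_mx (a ^+ 2 * T%:R)%:M (a * t)%:M (a * t)%:M (t ^+ 2)%:M.
Proof.
rewrite /V tr_col_mx mul_col_row.
congr block_mx; apply/matrixP => i j; rewrite !ord1 !mxE.
- under eq_bigr do rewrite !mxE.
  by rewrite sumr_const card_ord mulr1n mulr_natr.
- rewrite (bigD1 j0) //= big1 ?mxE ?eqxx /= ?mulr1 ?addr0 //.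
  by move=> k /negPf k0; rewrite !mxE k0 !mulr0.
- rewrite (bigD1 j0) //= big1 ?mxE ?eqxx /= ?mulr1 ?addr0 1?mulrC //.
  by move=> k /negPf k0; rewrite !mxE k0 mulr0 mul0r.
- rewrite (bigD1 j0) //= big1 ?mxE ?eqxx /= ?mulr1 ?addr0 //.
  by move=> k /negPf k0; rewrite !mxE k0 !mulr0.
Qed.

(** The squares of the two singular values have sum
[a^2 n T + 2 a t + t^2] and product [a^2 t^2 (n - 1) (T - 1)]. The sum is at
least, and the product at most, what the squares [a^2 n T] and [t^2] of the
singular values of the two rank one summands would give. At [t = 0] the bound
on the second singular value forces it to vanish. *)
Lemma singular_value_spiked_mx : (2 <= T)%N -> 0 <= a -> 0 <= t ->
  a * Num.sqrt (n * T)%:R <= singular_value 1 spiked_mx /\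
  0 <= singular_value 2 spiked_mx <= t.
Proof.
move=> T2 a0 t0.
have n1 : (1 : R) <= n%:R by rewrite ler1n; case: n i0 => // -[].
have T1 : (1 : R) <= T%:R by rewrite ler1n ltnW.
pose G := U^T *m U *m (V *m V^T).
have trG : \tr G = a ^+ 2 * n%:R * T%:R + 2 * (a * t) + t ^+ 2.
  rewrite /G UU VV mulmx_block mxtrace_block !mul1mx mul_scalar_mx !raddfD /=.
  by rewrite linearZ /= !mxtrace_scalar !mulr1n; ring.
have detG : \det G = a ^+ 2 * t ^+ 2 * (n%:R - 1) * (T%:R - 1).
  by rewrite /G det_mulmx UU VV !det_block_scalar11; ring.
have [|||||s1 [s2 [trE detE xs1 s2y s21]]] :=
  @quadratic_roots R (a ^+ 2 * n%:R * T%:R) (t ^+ 2) (\tr G) (\det G).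
- by rewrite !mulr_ge0 // sqr_ge0.
- by rewrite sqr_ge0.
- by rewrite trG; have := mulr_ge0 a0 t0; lra.
- by rewrite detG !mulr_ge0 ?sqr_ge0 // subr_ge0.
- rewrite detG -subr_ge0.
  rewrite (_ : _ - _ = a ^+ 2 * t ^+ 2 * (n%:R - 1 + T%:R)); last by ring.
  by rewrite !mulr_ge0 ?sqr_ge0 //; lra.
have [s20 s2t] := andP s2y.
(* Two factors ['X] are cancelled because the reduction to [2 x 2] matrices
   equates the two polynomials up to powers of ['X]. *)
have chi : char_poly (spiked_mx^T *m spiked_mx)
    = ('X - s1%:P) * ('X - s2%:P) * 'X ^+ (T - 2).
  apply: (@mulfI _ ('X ^+ 2)); first by rewrite expf_neq0 // polyX_eq0.
  rewrite spiked_mxE trmx_mul -mulmxA char_poly_mulmxC.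
  rewrite (mulmxA U^T) -[_ *m _ *m V^T]mulmxA.
  rewrite (char_poly_mx2 trE detE) [RHS]mulrCA -exprD subnKC //.
  exact: mulrC.
have [-> ->] := singular_value_rank2 chi s20 s21.
split.
  rewrite -[a]ger0_norm // -sqrtr_sqr -sqrtrM ?sqr_ge0 // ler_wsqrtr //.
  by rewrite natrM mulrA.
rewrite sqrtr_ge0 -[t]ger0_norm // -sqrtr_sqr ler_wsqrtr //.
Qed.

End spike.

(** * Length and coverage of random intervals *)

(** By Tonelli, the expected length is the Lebesgue integral over all [x] of the
probability that [x] is covered, and restricting it to [[a, b]] can only decrease it. *)
Lemma expected_length_ge_coverage (R : realType) d (Omega : measurableType d)
    (P : probability Omega R) (l h : Omega -> R) (a b p : R) :
  measurable_fun setT l -> measurable_fun setT h -> (forall w, l w <= h w) ->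
  a <= b -> 0 <= p ->
  (forall x, a <= x <= b -> (p%:E <= P [set w | l w <= x <= h w]%R)%E) ->
  ((p * (b - a))%:E <= \int[P]_w (h w - l w)%R%:E)%E.
Proof.
move=> ml mh lh ab p0 cover.
pose A : set (Omega * measurableTypeR R) := [set z | l z.1 <= z.2 <= h z.1].
have mA : measurable A.
  rewrite (_ : A = ([set: Omega * measurableTypeR R] `&` [set z | l z.1 <= z.2])
                `&` ([set: Omega * measurableTypeR R] `&` [set z | z.2 <= h z.1])).
    apply: measurableI; apply: measurable_fun_le => //.
    + exact: measurableT_comp ml _.
    + exact: measurableT_comp mh _.
  by rewrite !setTI; apply/seteqP; split=> z => [/andP[]|[lz zh]] //; apply/andP.
have <- : (\int[P]_w lebesgue_measure (xsection A w) = \int[P]_w (h w - l w)%R%:E)%E.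
  apply: eq_integral => w _.
  have -> : xsection A w = `[l w, h w]%classic.
    by rewrite xsectionE; apply/seteqP; split=> x /=; rewrite /A /= in_itv.
  rewrite lebesgue_measure_itv /= lte_fin -EFinB; case: ltP => // hl.
  by rewrite (_ : h w = l w) ?subrr //; apply/le_anti; rewrite hl lh.
have := @indic_fubini_tonelli _ _ Omega (measurableTypeR R) R P
  lebesgue_measure A mA.
rewrite indic_fubini_tonelli_FE // indic_fubini_tonelli_GE // => ->.
have mG := measurable_fun_ysection P mA.
have <- : (\int[lebesgue_measure]_(x in `[a, b]) p%:E = (p * (b - a))%:E)%E.
  rewrite integral_cst //= lebesgue_measure_itv /= lte_fin -EFinB.
  case: ltP => [//|ba]; rewrite (_ : b = a) ?subrr ?mulr0 ?mule0 //.
  by apply/le_anti; rewrite ba ab.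
apply: (@le_trans _ _ (\int[lebesgue_measure]_(x in `[a, b]) (P \o ysection A) x)%E).
  apply: ge0_le_integral => //.
    by apply: (measurable_funS (E := setT)) mG => //.
  move=> x; rewrite /= in_itv => /cover.
  by rewrite ysectionE.
by apply: ge0_subset_integral.
Qed.

Section masked_data.
Context {R : realType} {n T : nat} {d : measure_display}.
Context {Omega : measurableType d} (P : probability Omega R).
Context (u : 'I_n -> 'I_T -> {RV P >-> R}) (i0 : 'I_n) (j0 : 'I_T).

Lemma measurable_observed_data (M : 'M[R]_(n, T)) :
  measurable_fun setT (observed_data u i0 j0 M : Omega -> measurable_mx R n T).
Proof.
apply: (@measurability _ _ Omega (measurable_mx R n T) setT _
  (@mx_entry_events R n T)) => //.
move=> _ [_ [[i j] _ [B mB <-]] <-]; rewrite !setTI /=.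
suff mij : measurable_fun setT (fun w => observed_data u i0 j0 M w i j).
  by have := mij measurableT B mB; rewrite setTI.
rewrite /observed_data /mask_entry /full_data.
under eq_fun do rewrite mxE.
case: ((i == i0) && (j == j0)); first exact: measurable_cst.
under eq_fun do rewrite !mxE.
exact: measurable_funD.
Qed.

(** The spike sits on the masked entry, so the data do not depend on its height,
for any realization of the noise and not only in law. *)
Lemma observed_data_spiked (a t t' : R) :
  observed_data u i0 j0 (spiked_mx i0 j0 a t)
    = observed_data u i0 j0 (spiked_mx i0 j0 a t').
Proof.
apply/funext => w; apply/matrixP => i j; rewrite !mxE.
by case: ifP => // ->; rewrite !mulr0.
Qed.

End masked_data.

(** * The lower bound *)

Theorem theorem3 (R : realType) (alpha kappa kappa1 : R)
    (alpha01 : 0 < alpha < 1) (kappa_gt0 : 0 < kappa) (kappa1_gt0 : 0 < kappa1) :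
  exists2 C : R, 0 < C &
    forall (n T : nat) (hn : (2 <= n)%N) (hT : (2 <= T)%N)
           (tau0 tau1 tau2 : R),
      tau1 <= tau0 -> tau2 <= tau1 -> 0 < tau2 ->
      tau1 <= kappa * Num.sqrt (n * T)%:R / 12 ->
      tau0 <= kappa * Num.sqrt (n * T)%:R / 12 ->
      kappa1 <= tau2 ->
    forall (d : measure_display) (Omega : measurableType d)
           (P : probability Omega R) (u : 'I_n -> 'I_T -> {RV P >-> R}),
      iid_std_normal u ->
      (C%:E <= minimax_length u (Ordinal (ltnW hn)) (Ordinal (ltnW hT)) alpha
                 (classM1 kappa tau0) (classM2 kappa tau1 tau2))%E.
Proof.
have [alpha0 alpha1] := andP alpha01.
(* [kappa1] keeps the second singular value below [tau2], and [kappa / 2] keeps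
   the entry [kappa / 12 + t] below [kappa]. *)
pose Delta := Num.min kappa1 (kappa / 2).
have Delta0 : 0 < Delta by rewrite lt_min kappa1_gt0 divr_gt0.
exists ((1 - alpha) * Delta); first by rewrite mulr_gt0 // subr_gt0.
move=> n T hn hT tau0 tau1 tau2 _ _ _ tau1_le tau0_le tau2_ge d Omega P u _.
set i0 := Ordinal (ltnW hn); set j0 := Ordinal (ltnW hT).
pose a := kappa / 12; have a0 : 0 <= a by rewrite divr_ge0 // ltW.
pose M := spiked_mx i0 j0 a.
have Mij t : 0 <= t <= Delta -> classM kappa (M t).
  move=> /andP[t0]; rewrite le_min => /andP[_ tk]; split; last exact: rank_spiked_mx.
  rewrite mx_normrE; apply/bigmax_leP; split; first exact: ltW.
  move=> ij _; rewrite !mxE ger0_norm; last by rewrite addr_ge0 // mulr_ge0.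
  have : t * ((ij.1 == i0) && (ij.2 == j0))%:R <= t.
    by rewrite ler_piMr // lern1 leq_b1.
  rewrite /a; lra.
have sqrtE : kappa * Num.sqrt (n * T)%:R / 12 = a * Num.sqrt (n * T)%:R.
  by rewrite /a mulrAC.
have M2 t : 0 <= t <= Delta -> classM2 kappa tau1 tau2 (M t).
  move=> tD; have [t0] := andP tD; rewrite le_min => /andP[tk _].
  have [s1 /andP[_ s2]] := singular_value_spiked_mx i0 j0 hT a0 t0.
  split; [exact: Mij|by apply: le_trans s1; rewrite -sqrtE|].
  by apply: le_trans s2 (le_trans tk _).
have M1 : classM1 kappa tau0 (M 0).
  have [s1 s2] := singular_value_spiked_mx i0 j0 hT a0 (lexx 0).
  split; [by apply: Mij; rewrite lexx ltW|by apply: le_trans s1; rewrite -sqrtE|].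
  exact/esym/le_anti.
apply: le_ereal_inf_tmp => _ [CI validCI <-].
apply: le_trans (ereal_sup_ubound _); last by exists (M 0).
rewrite /expected_length unlock.
rewrite (_ : Delta = a + Delta - a); last by rewrite addrAC subrr add0r.
apply: expected_length_ge_coverage.
- exact: measurableT_comp (measurable_lower CI) (measurable_observed_data _ _ _ _).
- exact: measurableT_comp (measurable_upper CI) (measurable_observed_data _ _ _ _).
- by move=> w; exact: lower_le_upper.
- by rewrite lerDl ltW.
- by rewrite subr_ge0 ltW.
move=> x /andP[ax xaD].
apply: le_trans validCI (ereal_inf_lbound _); exists (M (x - a)).
  by apply: M2; rewrite subr_ge0 ax lerBlDl.
rewrite /coverage (observed_data_spiked _ _ _ _ _ 0).
by rewrite !mxE !eqxx mulr1 addrCA subrr addr0.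
Qed.
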